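(* Let $z=(z_1,z_2,z_3)$ be the cycle structure of some isotopism in $S_n^3$ that is an autotopism of a non-empty partial Latin square of order $n$, and let $\Theta\in S_n^3$ have cycle structure $z$. Let $\mathfrak{l}_z=\min_{(i,j)\in\mathrm{LCM}_z}\mathrm{lcm}(i,j)$. Then the number of partial Latin squares of order $n$ and size $\mathfrak{l}_z$ having $\Theta$ as an autotopism equals $$\sum_{\substack{(i,j)\in\mathrm{LCM}_z\\ \mathrm{lcm}(i,j)=\mathfrak{l}_z}} z_{1i}\, z_{2j}\,\gcd(i,j)\sum_{\substack{k\in[n]\\ (i,j,k)\in\mathrm{LCM}_n}} k\, z_{3k}.$$
   Context: A partial Latin square of order $n$ is an $n\times n$ array whose cells are empty or contain a symbol of $[n]$, each symbol at most once per row and column; its size is the number of filled cells and $O(P)$ is its set of (row, column, symbol) triples of filled cells. $\Theta=(\alpha,\beta,\gamma)$ is an autotopism of $P$ if $\{(\alpha(r),\beta(c),\gamma(s)):(r,c,s)\in O(P)\}=O(P)$. The cycle structure of $\Theta$ is $(z_\alpha,z_\beta,z_\gamma)$ (cycles of each length, fixed points as 1-cycles); $z_{ij}$ is the number of cycles of length $j$ in $z_i$. $\mathrm{LCM}_n=\{(i,j,k)\in[n]^3:\mathrm{lcm}(i,j)=\mathrm{lcm}(i,k)=\mathrm{lcm}(j,k)=\mathrm{lcm}(i,j,k)\}$ and $\mathrm{LCM}_z=\{(i,j)\in[n]^2:\exists k\text{ with }(i,j,k)\in\mathrm{LCM}_n\text{ and }z_{1i}z_{2j}z_{3k}>0\}$.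 *)

(* Defs.v *)
From mathcomp Require Import all_boot all_fingroup all_algebra.
Set Implicit Arguments.
Unset Strict Implicit.
Unset Printing Implicit Defensive.

(* Rows, columns and symbols are indexed by
   'I_n = {0, ..., n-1}; the empty cell is None. *)

Definition at_most_once_per_row n (P : 'M[option 'I_n]_n) : bool :=
  [forall r, forall s, #|[set c | P r c == Some s]| <= 1].

Definition at_most_once_per_column n (P : 'M[option 'I_n]_n) : bool :=
  [forall c, forall s, #|[set r | P r c == Some s]| <= 1].

Definition partial_latin_square n (P : 'M[option 'I_n]_n) : bool :=
  at_most_once_per_row P && at_most_once_per_column P.

Definition pls_size n (P : 'M[option 'I_n]_n) : nat :=
  #|[set rc : 'I_n * 'I_n | P rc.1 rc.2 != None]|.

Definition entries n (P : 'M[option 'I_n]_n)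
    : {set 'I_n * 'I_n * 'I_n} :=
  [set t | P t.1.1 t.1.2 == Some t.2].

Definition isotopism n : Type := ('S_n * 'S_n * 'S_n)%type.

Definition isotopism_act n (Theta : isotopism n) (t : 'I_n * 'I_n * 'I_n)
    : 'I_n * 'I_n * 'I_n :=
  let: (alpha, beta, gamma) := Theta in
  (alpha t.1.1, beta t.1.2, gamma t.2).

Definition autotopism n (Theta : isotopism n) (P : 'M[option 'I_n]_n) : bool :=
  [set isotopism_act Theta t | t in entries P] == entries P.

(* The value at j is the number of cycles of length j, the fixed points being
   the cycles of length 1. Lengths live in 'I_n.+1 = {0, ..., n}; the value at 0
   is 0, and [n] is the set of the i : 'I_n.+1 with 0 < i. *)
Definition perm_cycle_structure n (s : 'S_n) : {ffun 'I_n.+1 -> nat} :=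
  [ffun j : 'I_n.+1 => #|[set C in porbits s | #|C| == j]|].

Definition cycle_structure n (Theta : isotopism n) :=
  let: (alpha, beta, gamma) := Theta in
  (perm_cycle_structure alpha, perm_cycle_structure beta,
   perm_cycle_structure gamma).

Definition LCM_n n : {set 'I_n.+1 * 'I_n.+1 * 'I_n.+1} :=
  [set t : 'I_n.+1 * 'I_n.+1 * 'I_n.+1 | let: (i, j, k) := t in
    [&& 0 < i, 0 < j, 0 < k,
        lcmn i j == lcmn i k,
        lcmn i k == lcmn j k &
        lcmn j k == lcmn (lcmn i j) k]].

Definition LCM_z n (z1 z2 z3 : {ffun 'I_n.+1 -> nat})
    : {set 'I_n.+1 * 'I_n.+1} :=
  [set p : 'I_n.+1 * 'I_n.+1 | let: (i, j) := p in
    [exists k, ((i, j, k) \in LCM_n n) && (0 < z1 i * z2 j * z3 k)]].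

(* The minimum of lcm(i, j) over LCM_z. Since lcm(i, j) <= i * j <= n * n, the
   neutral value n * n does not affect the minimum of a non-empty set. *)
Definition min_lcm n (z1 z2 z3 : {ffun 'I_n.+1 -> nat}) : nat :=
  \big[minn/n * n]_(p in LCM_z z1 z2 z3) lcmn p.1 p.2.

(* Main.v *)
(** By invariance under powers of Theta, a filled cell of P whose row, column
    and symbol lie in cycles of lengths i, j, k forces (i, j, k) to be in LCM_n,
    and its orbit under Theta has size lcm(i, j) >= l_z. Hence P of size l_z is
    a single orbit; conversely every orbit of such a triple with
    lcm(i, j) = l_z is a partial Latin square. Counting the pairs (P, filled
    cell of P) in two ways gives
    l_z * #P = sum of (i z_1i) (j z_2j) (k z_3k) over these (i, j, k), and
    i j = gcd(i, j) l_z. *)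

Require Import Defs.
From mathcomp Require Import all_boot all_fingroup all_algebra.

Set Implicit Arguments.
Unset Strict Implicit.
Unset Printing Implicit Defensive.

(** * Cycles of a single permutation *)

(** Only the remainder of [m] modulo the cycle length matters, and the iterates of [x] below that
    length are pairwise distinct. *)
Lemma permX_eq_dvdn (T : finType) (s : {perm T}) (x : T) (m : nat) :
  ((s ^+ m)%g x == x) = (#|porbit s x| %| m).
Proof.
have s_pos : 0 < #|porbit s x| by rewrite lt0n card_porbit_neq0.
have iterM q : iter (q * #|porbit s x|) s x = x.
  by elim: q => // q IHq; rewrite mulSn iterD IHq iter_porbit.
rewrite permX {1}(divn_eq m #|porbit s x|) addnC iterD iterM /dvdn.
have lt_m := ltn_pmod m s_pos.
rewrite -(nth_traject s lt_m).
rewrite -[X in _ == X](nth_traject s s_pos x : _ = x).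
by rewrite nth_uniq ?size_traject ?uniq_traject_porbit.
Qed.

(** The points lying in cycles of length [j] are partitioned by those cycles, with [j] points in
    each. *)
Lemma card_porbit_eq (T : finType) (s : {perm T}) (j : nat) :
  #|[set x | #|porbit s x| == j]| = j * #|[set C in porbits s | #|C| == j]|.
Proof.
set Q := [set C in porbits s | _]; rewrite mulnC -sum_nat_const -sum1_card.
rewrite (partition_big (porbit s) (mem Q)) => [|x]; last first.
  by rewrite !inE imset_f.
apply: eq_bigr => _ /setIdP[/imsetP[x _ ->] /eqP <-].
rewrite sum1_card; apply: eq_card => y; rewrite unfold_in /= !inE eq_porbit_mem.
by rewrite andb_idl // -eq_porbit_mem => /eqP ->.
Qed.

(** * The permutation of triples induced by an isotopism *)

Section Isotopism.

Variables (n : nat) (Theta : isotopism n).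
Implicit Types (t : 'I_n * 'I_n * 'I_n) (P : 'M[option 'I_n]_n).

Let alpha : 'S_n := Theta.1.1.
Let beta : 'S_n := Theta.1.2.
Let gamma : 'S_n := Theta.2.

Lemma isotopism_act_inj : injective (isotopism_act Theta).
Proof.
rewrite /isotopism_act; case: Theta => [[a b] g] [[r c] s] [[r' c'] s'] /=.
by case=> /perm_inj-> /perm_inj-> /perm_inj->.
Qed.

Definition triple_perm : {perm 'I_n * 'I_n * 'I_n} := perm isotopism_act_inj.

Lemma triple_permX m t :
  (triple_perm ^+ m)%g t =
  ((alpha ^+ m)%g t.1.1, (beta ^+ m)%g t.1.2, (gamma ^+ m)%g t.2).
Proof.
rewrite !permX /alpha /beta /gamma; elim: m => [|m IHm] /=.
  by case: t => [[]].
by rewrite {}IHm permE /isotopism_act; case: Theta => [[]].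
Qed.

Definition row_len t := #|porbit alpha t.1.1|.
Definition col_len t := #|porbit beta t.1.2|.
Definition sym_len t := #|porbit gamma t.2|.

Lemma triple_permX_eq m t :
  ((triple_perm ^+ m)%g t == t) =
  [&& row_len t %| m, col_len t %| m & sym_len t %| m].
Proof.
rewrite triple_permX -!permX_eq_dvdn -/alpha.
by case: t => [[r c] s]; rewrite !xpair_eqE andbA.
Qed.

(** A power fixes [t] exactly when its exponent is a common multiple of the three cycle lengths, and
    the orbit size is the least positive such exponent. *)
Lemma card_porbit_triple t :
  #|porbit triple_perm t| = lcmn (lcmn (row_len t) (col_len t)) (sym_len t).
Proof.
apply/eqP; rewrite eqn_dvd -permX_eq_dvdn triple_permX_eq.
have := dvdnn #|porbit triple_perm t|.
rewrite -permX_eq_dvdn triple_permX_eq => /and3P[ri cj sk].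
rewrite !dvdn_lcm ri cj sk dvdn_lcmr !andbT /=.
by apply/andP; split; apply: dvdn_trans (dvdn_lcml _ _);
  rewrite ?dvdn_lcml ?dvdn_lcmr.
Qed.

Definition lcm_triple t :=
  [&& lcmn (row_len t) (col_len t) == lcmn (row_len t) (sym_len t),
      lcmn (row_len t) (sym_len t) == lcmn (col_len t) (sym_len t) &
      lcmn (col_len t) (sym_len t)
        == lcmn (lcmn (row_len t) (col_len t)) (sym_len t)].

(** In this form the condition says that a power fixing two coordinates of [t] fixes the third. *)
Lemma lcm_tripleP t :
  reflect [/\ sym_len t %| lcmn (row_len t) (col_len t),
              col_len t %| lcmn (row_len t) (sym_len t) &
              row_len t %| lcmn (col_len t) (sym_len t)]
          (lcm_triple t).
Proof.
rewrite /lcm_triple; move: (row_len t) (col_len t) (sym_len t) => i j k.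
apply: (iffP and3P) => [[/eqP e1 /eqP e2 /eqP e3]|[kij jik ijk]].
  split; first by rewrite e1 dvdn_lcmr.
    by rewrite e2 dvdn_lcml.
  by rewrite -e2 dvdn_lcml.
have e1 : lcmn i j = lcmn i k.
  by apply/eqP; rewrite eqn_dvd !dvdn_lcm jik kij !dvdn_lcml.
have e2 : lcmn i k = lcmn j k.
  by apply/eqP; rewrite eqn_dvd !dvdn_lcm ijk jik !dvdn_lcmr.
split; [exact/eqP | exact/eqP |].
by rewrite -lcmnA eqn_dvd dvdn_lcmr dvdn_lcm ijk dvdnn.
Qed.

(** * Entries of partial Latin squares and their invariance *)

Lemma entriesE P t : (t \in entries P) = (P t.1.1 t.1.2 == Some t.2).
Proof. by rewrite inE. Qed.

Lemma card_entries P : #|entries P| = pls_size P.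
Proof.
rewrite /pls_size -(@card_in_imset _ _ (fun t => t.1) (entries P)); last first.
  move=> [[r c] s] [[r' c'] s']; rewrite !entriesE /= => /eqP Ps /eqP Ps' [rr' cc'].
  by move: Ps'; rewrite -rr' -cc' Ps => -[->].
apply: eq_card => rc; rewrite inE; apply/imsetP/idP => [[t]|].
  by rewrite entriesE => /eqP Pt ->; rewrite Pt.
case Prc: (P rc.1 rc.2) => [s|//] _; exists (rc, s) => //.
by rewrite entriesE /= Prc.
Qed.

Lemma entries_inj : injective (@entries n).
Proof.
move=> P Q PQ; apply/matrixP => r c.
have eqPQ s : (P r c == Some s) = (Q r c == Some s).
  by rewrite -!(entriesE _ (r, c, s)) PQ.
case Prc: (P r c) => [s|]; first by apply/esym/eqP; rewrite -eqPQ Prc.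
by case Qrc: (Q r c) => [s|//]; move: (eqPQ s); rewrite Prc Qrc eqxx.
Qed.

Lemma partial_latin_squareP P :
  reflect
    ((forall r c c' s, (r, c, s) \in entries P -> (r, c', s) \in entries P ->
        c = c') /\
     (forall r r' c s, (r, c, s) \in entries P -> (r', c, s) \in entries P ->
        r = r'))
    (partial_latin_square P).
Proof.
apply: (iffP andP) => [[/forallP rowP /forallP colP]|[rowP colP]]; split.
- move=> r c c' s; rewrite !entriesE /= => Pc Pc'.
  by have /forallP/(_ s)/card_le1_eqP := rowP r; apply; rewrite inE.
- move=> r r' c s; rewrite !entriesE /= => Pr Pr'.
  by have /forallP/(_ s)/card_le1_eqP := colP c; apply; rewrite inE.
- apply/forallP=> r; apply/forallP=> s; apply/card_le1_eqP=> c c'.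
  by rewrite !inE => Pc Pc'; apply: (rowP r _ _ s); rewrite entriesE.
- apply/forallP=> c; apply/forallP=> s; apply/card_le1_eqP=> r r'.
  by rewrite !inE => Pr Pr'; apply: (colP _ _ c s); rewrite entriesE.
Qed.

Lemma autotopism_triple_permX P m t : autotopism Theta P ->
  t \in entries P -> (triple_perm ^+ m)%g t \in entries P.
Proof.
move=> /eqP autP tP; rewrite permX; elim: m => //= m IHm.
by rewrite permE -autP imset_f.
Qed.

Lemma porbit_sub_entries P t : autotopism Theta P ->
  t \in entries P -> porbit triple_perm t \subset entries P.
Proof.
move=> autP tP; apply/subsetP => _ /porbitP[m ->].
exact: autotopism_triple_permX.
Qed.

(** The power with exponent the lcm of two of the lengths fixes two coordinates of [t] and sends [t]
    to an entry. A cell holds one symbol, and a symbol occurs once per row and column, so the third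
    coordinate is fixed too and its length divides the exponent. *)
Lemma entries_lcm_triple P t : partial_latin_square P -> autotopism Theta P ->
  t \in entries P -> lcm_triple t.
Proof.
move=> /partial_latin_squareP[rowP colP] autP tP.
have fixP m := autotopism_triple_permX m autP tP.
apply/lcm_tripleP; split; rewrite -permX_eq_dvdn.
- set m := lcmn _ _; have := fixP m; rewrite triple_permX.
  have /eqP-> : (alpha ^+ m)%g t.1.1 == t.1.1 by rewrite permX_eq_dvdn dvdn_lcml.
  have /eqP-> : (beta ^+ m)%g t.1.2 == t.1.2 by rewrite permX_eq_dvdn dvdn_lcmr.
  by move: tP; rewrite !entriesE /= => /eqP-> /eqP[<-].
- set m := lcmn _ _; have := fixP m; rewrite triple_permX.
  have /eqP-> : (alpha ^+ m)%g t.1.1 == t.1.1 by rewrite permX_eq_dvdn dvdn_lcml.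
  have /eqP-> : (gamma ^+ m)%g t.2 == t.2 by rewrite permX_eq_dvdn dvdn_lcmr.
  case: t tP {fixP} @m => [[r c] s] tP m mP.
  by apply/eqP; apply: rowP mP tP.
- set m := lcmn _ _; have := fixP m; rewrite triple_permX.
  have /eqP-> : (beta ^+ m)%g t.1.2 == t.1.2 by rewrite permX_eq_dvdn dvdn_lcml.
  have /eqP-> : (gamma ^+ m)%g t.2 == t.2 by rewrite permX_eq_dvdn dvdn_lcmr.
  case: t tP {fixP} @m => [[r c] s] tP m mP.
  by apply/eqP; apply: colP mP tP.
Qed.

(** * Orbits as partial Latin squares *)

Lemma card_porbit_lcm_triple t : lcm_triple t ->
  #|porbit triple_perm t| = lcmn (row_len t) (col_len t).
Proof.
by case/and3P=> /eqP e1 /eqP e2 /eqP e3; rewrite card_porbit_triple -e3 -e2 -e1.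
Qed.

(* A power of Theta that fixes two coordinates of t fixes the third one. *)
Lemma porbit_lcm_triple_inj t u v : lcm_triple t ->
  u \in porbit triple_perm t -> v \in porbit triple_perm t ->
  [\/ u.1.1 = v.1.1 /\ u.1.2 = v.1.2, u.1.1 = v.1.1 /\ u.2 = v.2
    | u.1.2 = v.1.2 /\ u.2 = v.2] -> u = v.
Proof.
(* The orbit is rebased at [u], so that [v] is the image of [u] under a power. *)
move=> lt ut; rewrite -(eqP (_ : porbit triple_perm u == porbit triple_perm t));
  last by rewrite eq_porbit_mem.
case/porbitP=> m ->{v}.
(* Cycle lengths are constant along the orbit, so [u] inherits the condition from [t]. *)
have /lcm_tripleP[kij jik ijk] : lcm_triple u.
  case/porbitP: ut => k ->; move: lt; rewrite /lcm_triple /row_len /col_len.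
  by rewrite /sym_len triple_permX !porbit_perm.
move=> fix2; apply/esym/eqP; rewrite triple_permX_eq; apply/and3P.
move: fix2; rewrite triple_permX /=.
have lenE (s : 'S_n) x : x = (s ^+ m)%g x -> #|porbit s x| %| m.
  by move=> sx; rewrite -permX_eq_dvdn -sx.
by case=> -[/lenE lt1 /lenE lt2]; split=> //;
  [apply: dvdn_trans kij _|apply: dvdn_trans jik _|apply: dvdn_trans ijk _];
  rewrite dvdn_lcm; apply/andP.
Qed.

(** Under [lcm_triple t] at most one symbol qualifies per cell; otherwise [pick] makes an arbitrary
    choice. *)
Definition porbit_matrix t : 'M[option 'I_n]_n :=
  (\matrix_(r, c) [pick s | (r, c, s) \in porbit triple_perm t])%R.

Lemma entries_porbit_matrix t : lcm_triple t ->
  entries (porbit_matrix t) = porbit triple_perm t.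
Proof.
move=> lt; apply/setP => -[[r c] s]; rewrite entriesE mxE /=.
case: pickP => [s' s'P|noP]; last by rewrite noP.
apply/eqP/idP => [[<-//]|sP]; congr Some.
by have [] := porbit_lcm_triple_inj lt s'P sP (Or31 _ _ (conj erefl erefl)).
Qed.

Lemma porbit_matrix_pls t : lcm_triple t ->
  partial_latin_square (porbit_matrix t).
Proof.
move=> lt; apply/partial_latin_squareP; rewrite entries_porbit_matrix //.
split=> [r c c' s|r r' c s] uP vP.
  have [] // : (r, c, s) = (r, c', s).
  by apply: porbit_lcm_triple_inj lt uP vP _; constructor 2.
have [] // : (r, c, s) = (r', c, s).
by apply: porbit_lcm_triple_inj lt uP vP _; constructor 3.
Qed.

(** The action is injective, so mapping the orbit into itself is enough, by cardinality. *)
Lemma porbit_matrix_autotopism t : lcm_triple t ->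
  autotopism Theta (porbit_matrix t).
Proof.
move=> lt; rewrite /autotopism entries_porbit_matrix // eqEcard.
rewrite (card_imset _ isotopism_act_inj) leqnn andbT.
apply/subsetP => _ /imsetP[_ /porbitP[m ->] ->].
by apply/porbitP; exists m.+1; rewrite expgSr permM [RHS]permE.
Qed.

(** * Counting triples by cycle lengths *)

(** Typed as an index of cycle structures; [inord] keeps the value, since a cycle has at most [n]
    points. *)
Definition cycle_len (s : 'S_n) x : 'I_n.+1 := inord #|porbit s x|.

Lemma cycle_lenE s x : cycle_len s x = #|porbit s x| :> nat.
Proof. by rewrite inordK // ltnS -[leqRHS]card_ord max_card. Qed.

Definition cycle_lens t :=
  (cycle_len alpha t.1.1, cycle_len beta t.1.2, cycle_len gamma t.2).

Lemma cycle_lens_LCM t : (cycle_lens t \in LCM_n n) = lcm_triple t.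
Proof. by rewrite inE /cycle_lens !cycle_lenE !lt0n !card_porbit_neq0. Qed.

Lemma card_cycle_len (s : 'S_n) (j : 'I_n.+1) :
  #|[set x | cycle_len s x == j]| = j * perm_cycle_structure s j.
Proof.
rewrite ffunE -card_porbit_eq; apply: eq_card => x.
by rewrite !inE -val_eqE /= cycle_lenE.
Qed.

Lemma card_cycle_lens i j k :
  #|[set t | cycle_lens t == (i, j, k)]| =
  (i * perm_cycle_structure alpha i) * (j * perm_cycle_structure beta j)
    * (k * perm_cycle_structure gamma k).
Proof.
rewrite -!card_cycle_len -!cardsX; apply: eq_card => -[[r c] s].
by rewrite !inE /= !xpair_eqE.
Qed.

Lemma perm_cycle_structure_gt0 (s : 'S_n) x :
  0 < perm_cycle_structure s (cycle_len s x).
Proof.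
rewrite ffunE; apply/card_gt0P; exists (porbit s x).
by rewrite inE imset_f //= cycle_lenE.
Qed.

Let z1 := perm_cycle_structure alpha.
Let z2 := perm_cycle_structure beta.
Let z3 := perm_cycle_structure gamma.

Lemma cycle_lens_LCM_z t : lcm_triple t -> (cycle_lens t).1 \in LCM_z z1 z2 z3.
Proof.
move=> lt; rewrite inE; apply/existsP; exists (cycle_len gamma t.2).
by rewrite cycle_lens_LCM lt !muln_gt0 !perm_cycle_structure_gt0.
Qed.

(** One side of the double counting: triples are sorted first by the lengths [(i, j)] of their row
    and column cycles, then by the length [k] of the symbol cycle. *)
Lemma card_lcm_triples (l : nat) :
  #|[set t | lcm_triple t & #|porbit triple_perm t| == l]| =
  l * \sum_(p in LCM_z z1 z2 z3 | lcmn p.1 p.2 == l)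
        z1 p.1 * z2 p.2 * gcdn p.1 p.2 *
          \sum_(k : 'I_n.+1 | (p.1, p.2, k) \in LCM_n n) k * z3 k.
Proof.
pose goodp (p : 'I_n.+1 * 'I_n.+1) :=
  (p \in LCM_z z1 z2 z3) && (lcmn p.1 p.2 == l).
have lenP t : lcm_triple t ->
    #|porbit triple_perm t| = lcmn (cycle_lens t).1.1 (cycle_lens t).1.2.
  by move=> lt; rewrite card_porbit_lcm_triple //= !cycle_lenE.
rewrite -sum1_card (partition_big (fun t => (cycle_lens t).1) goodp); last first.
  by move=> t; rewrite inE => /andP[lt]; rewrite /goodp cycle_lens_LCM_z // lenP.
rewrite big_distrr; apply: eq_bigr => -[i j] /andP[_ /= /eqP lij] /=.
rewrite (partition_big (fun t => (cycle_lens t).2)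
  (fun k => (i, j, k) \in LCM_n n)); last first.
  move=> t /andP[]; rewrite inE -cycle_lens_LCM => /andP[tL _] /eqP tij.
  by rewrite -tij.
rewrite mulnA big_distrr; apply: eq_bigr => k ijk.
transitivity #|[set t | cycle_lens t == (i, j, k)]|.
  rewrite sum1_card; apply: eq_card => t; rewrite unfold_in /= !inE.
  (* The lengths [(i, j, k)] alone determine the orbit size and the lcm condition, so the fibre
     consists of all triples with these lengths. *)
  rewrite -andbA andb_idl // => tijk.
  have tE : cycle_lens t = (i, j, k) by apply/eqP.
  have lt : lcm_triple t by rewrite -cycle_lens_LCM tE.
  by rewrite lt lenP // tE lij eqxx.
(* Here [i * j] is replaced by [l * gcdn i j]. *)
rewrite card_cycle_lens -/z1 -/z2 -/z3 (mulnACA i) -(muln_lcm_gcd i j) lij /=.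
by rewrite -(mulnA l) (mulnC (gcdn i j)).
Qed.

End Isotopism.

(** * The minimal lcm and the final double counting *)

Lemma min_lcm_le n (z1 z2 z3 : {ffun 'I_n.+1 -> nat}) p :
  p \in LCM_z z1 z2 z3 -> min_lcm z1 z2 z3 <= lcmn p.1 p.2.
Proof.
rewrite /min_lcm -big_filter => pL.
have: p \in [seq p <- index_enum _ | p \in LCM_z z1 z2 z3].
  by rewrite mem_filter pL mem_index_enum.
elim: [seq _ <- _ | _] => // q s IHs; rewrite inE big_cons.
by case/predU1P=> [<-|/IHs le_p]; rewrite geq_min ?leqnn // le_p orbT.
Qed.

(** Needed to cancel the factor [min_lcm z1 z2 z3] in the double counting; for [0 < n] the default
    value [n * n] is positive as well. *)
Lemma min_lcm_gt0 n (z1 z2 z3 : {ffun 'I_n.+1 -> nat}) :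
  0 < n -> 0 < min_lcm z1 z2 z3.
Proof.
move=> n0; rewrite /min_lcm; elim/big_ind: _ => [|x y x0 y0|[i j]].
- by rewrite muln_gt0 n0.
- by rewrite leq_min x0.
by rewrite inE => /existsP[k /andP[]]; rewrite inE lcmn_gt0 => /and3P[-> ->].
Qed.

Theorem theorem13 (n : nat) (z1 z2 z3 : {ffun 'I_n.+1 -> nat})
    (hz : exists (Theta' : isotopism n) (P' : 'M[option 'I_n]_n),
        [/\ cycle_structure Theta' = (z1, z2, z3),
            partial_latin_square P',
            0 < pls_size P' &
            autotopism Theta' P'])
    (Theta : isotopism n) (hTheta : cycle_structure Theta = (z1, z2, z3)) :
  #|[set P : 'M[option 'I_n]_n |
      [&& partial_latin_square P, pls_size P == min_lcm z1 z2 z3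
        & autotopism Theta P]]| =
  \sum_(p in LCM_z z1 z2 z3 | lcmn p.1 p.2 == min_lcm z1 z2 z3)
     z1 p.1 * z2 p.2 * gcdn p.1 p.2 *
       \sum_(k : 'I_n.+1 | (p.1, p.2, k) \in LCM_n n) k * z3 k.
Proof.
have n_gt0 : 0 < n.
  case: hz => _ [P [_ _ /card_gt0P[[r _] _] _]].
  exact: leq_ltn_trans (ltn_ord r).
have l_gt0 : 0 < min_lcm z1 z2 z3 by apply: min_lcm_gt0.
have [ez1 ez2 ez3] : [/\ perm_cycle_structure Theta.1.1 = z1,
    perm_cycle_structure Theta.1.2 = z2 & perm_cycle_structure Theta.2 = z3].
  by move: hTheta; case: (Theta) => [[a b] g] [].
have porbit_ge t : lcm_triple Theta t ->
    min_lcm z1 z2 z3 <= #|porbit (triple_perm Theta) t|.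
  move=> lt; rewrite card_porbit_lcm_triple //.
  by have := min_lcm_le (cycle_lens_LCM_z lt); rewrite ez1 ez2 ez3 /= !cycle_lenE.
(* The orbit of an entry lies in [entries P] and has at least as many elements, hence fills it. *)
have porbit_entries P t : partial_latin_square P ->
    pls_size P = min_lcm z1 z2 z3 -> autotopism Theta P -> t \in entries P ->
    porbit (triple_perm Theta) t = entries P.
  move=> plsP sizeP autP tP; apply/eqP.
  rewrite eqEcard porbit_sub_entries // card_entries sizeP.
  exact/porbit_ge/(entries_lcm_triple plsP).
set l := min_lcm z1 z2 z3 in l_gt0 porbit_ge porbit_entries *.
(* Multiplied by [l], the left side counts pairs of a square and one of its entries, and the right
   side counts triples with orbit of size [l]. *)
set S := [set P | _]; apply/eqP; rewrite -(eqn_pmul2l l_gt0); apply/eqP.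
have := card_lcm_triples Theta l; rewrite ez1 ez2 ez3 => <-.
pose F t : 'M[option 'I_n]_n := porbit_matrix Theta t.
(* Each triple is sent to the square formed by its orbit. *)
rewrite -[RHS]sum1_card [RHS](partition_big F (mem S)) => [|t]; last first.
  rewrite inE => /andP[lt /eqP tl]; rewrite /= inE /F porbit_matrix_pls //.
  rewrite porbit_matrix_autotopism // -card_entries entries_porbit_matrix //.
  by rewrite tl eqxx.
rewrite mulnC -sum_nat_const; apply: eq_bigr => P; rewrite inE.
case/and3P=> plsP /eqP sizeP autP; rewrite sum1_card -sizeP -card_entries.
(* The triples sent to [P] are exactly the entries of [P]. *)
apply: eq_card => t; rewrite [RHS]unfold_in /=; apply/idP/andP => [tP|].
  have lt := entries_lcm_triple plsP autP tP.
  have tE := porbit_entries _ _ plsP sizeP autP tP.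
  rewrite inE lt tE card_entries sizeP eqxx; split=> //.
  by apply/eqP/entries_inj; rewrite entries_porbit_matrix.
by rewrite inE => -[/andP[lt _] /eqP <-]; rewrite entries_porbit_matrix ?porbit_id.
Qed.
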